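(* Let $N=\{1,\dots,n\}$, let $\mathcal{F}\subseteq 2^N$ be downward closed, and let $a=(a_i)_{i\in N}$, $b=(b_i)_{i\in N\cup\{0\}}$ be real vectors with $b_0>0$, and $a_i\ge 0$, $b_i>0$ for all $i\in N$. If the set function $h(\cdot;a,b)$ is monotone nondecreasing over $\mathcal{F}$, then $h(\cdot;a,b)$ is submodular over $\mathcal{F}$.
   Context: For $S\subseteq N$, $h(S;a,b):=\dfrac{\sum_{i\in S}a_i}{b_0+\sum_{i\in S}b_i}$. A family $\mathcal{F}\subseteq 2^N$ is downward closed if $S\in\mathcal{F}$ and $T\subseteq S$ imply $T\in\mathcal{F}$. The function $h(\cdot;a,b)$ is monotone nondecreasing (over $\mathcal{F}$) if $h(S;a,b)\le h(S\cup\{j\};a,b)$ for every $S\subseteq N$ and $j\in N\setminus S$ such that $S\cup\{j\}\in\mathcal{F}$. A set function $f:2^N\to\mathbb{R}$ is submodular over $\mathcal{F}$ if $f(S\cup\{i\})-f(S)\ge f(T\cup\{i\})-f(T)$ for all $i\in N$ and all $S\subseteq T\subseteq N\setminus\{i\}$ such that $T\cup\{i\}\in\mathcal{F}$. *)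

(* Defs.v *)
From mathcomp Require Import all_boot all_order all_algebra.
Set Implicit Arguments.
Unset Strict Implicit.
Unset Printing Implicit Defensive.
Import GRing.Theory Num.Theory.
Local Open Scope ring_scope.

Definition downward_closed (I : finType) (F : {set {set I}}) : Prop :=
  forall S T : {set I}, S \in F -> T \subset S -> T \in F.

Definition monotone_over (R : realFieldType) (I : finType)
    (F : {set {set I}}) (f : {set I} -> R) : Prop :=
  forall (S : {set I}) (j : I),
    j \notin S -> S :|: [set j] \in F -> f S <= f (S :|: [set j]).

Definition submodular_over (R : realFieldType) (I : finType)
    (F : {set {set I}}) (f : {set I} -> R) : Prop :=
  forall (i : I) (S T : {set I}),
    S \subset T -> T \subset [set~ i] -> T :|: [set i] \in F ->
    f (T :|: [set i]) - f T <= f (S :|: [set i]) - f S.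

(* The ground set {1, ..., n} is 'I_n, numbered from 0.  The vector b is indexed
   by the ground set together with an extra index 0: [b ord0] is b_0, and
   [b (lift ord0 i)] is the entry of b attached to the element i of 'I_n. *)
Definition h (R : realFieldType) (n : nat) (a : 'I_n -> R) (b : 'I_n.+1 -> R)
    (S : {set 'I_n}) : R :=
  (\sum_(i in S) a i) / (b ord0 + \sum_(i in S) b (lift ord0 i)).

(* Main.v *)
(* The marginal of [h] at [S] is [(a_i - b_i h(S)) / (b_0 + b(S) + b_i)].  When
   [S] grows to [T], [h(S)] increases by monotonicity, so the numerator
   decreases; it is still nonnegative at [T], again by monotonicity, while the
   positive denominator increases. *)
Require Import Defs.
From mathcomp Require Import all_boot all_order all_algebra.
From mathcomp Require Import ring.
Import Order.TTheory GRing.Theory Num.Theory.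
Local Open Scope ring_scope.

(** Add the elements of [T :\: S] to [S] one at a time: every intermediate set lies inside [T],
    hence in [F] by downward closure, so the one-element hypothesis applies at each step. *)
Lemma monotone_over_subset {R : realFieldType} {I : finType}
    {F : {set {set I}}} {f : {set I} -> R} {S T : {set I}} :
  downward_closed F -> monotone_over F f ->
  S \subset T -> T \in F -> f S <= f T.
Proof.
move=> hF hf sST TF; have [k] := ubnP #|T :\: S|.
elim: k S sST => // k IHk S sST; rewrite ltnS => leTS.
have [/eqP | [x]] := set_0Vmem (T :\: S).
  by rewrite setD_eq0 => sTS; rewrite (_ : S = T) //; apply/eqP; rewrite eqEsubset sST.
move=> xTS; have [xT xS] := setDP xTS.
have sSxT : S :|: [set x] \subset T by rewrite subUset sST sub1set.
apply: le_trans (hf S x xS (hF _ _ TF sSxT)) (IHk _ sSxT _).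
by apply: leq_trans leTS; rewrite -setDDl [ltnRHS](cardsD1 x) xTS.
Qed.

Lemma h_marginal (R : realFieldType) (n : nat) (a : 'I_n -> R)
    (b : 'I_n.+1 -> R) (S : {set 'I_n}) (i : 'I_n) :
  let B := b ord0 + \sum_(j in S) b (lift ord0 j) in
  i \notin S -> B != 0 -> B + b (lift ord0 i) != 0 ->
  h a b (S :|: [set i]) - h a b S =
  (a i - b (lift ord0 i) * h a b S) / (B + b (lift ord0 i)).
Proof.
move=> /= iS B_neq0 Bi_neq0; rewrite /h setUC !big_setU1 //=.
(* Regroups the first denominator as $B + b_i$, the form in which it is assumed nonzero. *)
rewrite [X in _ / X]addrCA [X in _ / X]addrC.
by field; apply/andP.
Qed.

Theorem proposition1 (R : realFieldType) (n : nat) (F : {set {set 'I_n}})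
    (a : 'I_n -> R) (b : 'I_n.+1 -> R)
    (hF : downward_closed F)
    (hb0 : 0 < b ord0)
    (ha : forall i : 'I_n, 0 <= a i)
    (hb : forall i : 'I_n, 0 < b (lift ord0 i))
    (hmono : monotone_over F (h a b)) :
  submodular_over F (h a b).
Proof.
move=> i S T sST; rewrite subsetC sub1set inE => iT TiF.
have iS : i \notin S by apply: contra iT; apply: subsetP.
(* Only $T \cup \{i\}$ is given as a member of [F]; its subset [T] follows by downward closure. *)
have hST : h a b S <= h a b T.
  by apply: (monotone_over_subset hF hmono sST (hF _ _ TiF (subsetUl _ _))).
have sum_ge0 (U : {set 'I_n}) : 0 <= \sum_(j in U) b (lift ord0 j).
  by apply: sumr_ge0 => j _; apply: ltW.
have B_gt0 (U : {set 'I_n}) : 0 < b ord0 + \sum_(j in U) b (lift ord0 j).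
  by apply: ltr_wpDr.
have Bi_gt0 (U : {set 'I_n}) :
    0 < b ord0 + \sum_(j in U) b (lift ord0 j) + b (lift ord0 i).
  exact: addr_gt0.
have leB : \sum_(j in S) b (lift ord0 j) <= \sum_(j in T) b (lift ord0 j).
  by rewrite [leRHS](big_setID S) (setIidPr sST) lerDl.
have := hmono T i iT TiF; rewrite -subr_ge0 !h_marginal ?lt0r_neq0 //.
rewrite pmulr_lge0 ?invr_gt0 // => numT_ge0.
(* Numerators and inverse denominators are compared separately, which requires both factors at [T],
   the smaller side, to be nonnegative; for the numerator this is [numT_ge0]. *)
apply: ler_pM => //; first by rewrite invr_ge0 ltW.
  by rewrite lerD2l lerN2 ler_pM2l.
by rewrite lef_pV2 ?posrE // lerD2r lerD2l.
Qed.
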